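(* Let $\mathcal{H}$ be a real Hilbert space, let $m$ be a positive integer, let $T:\mathcal{H}\to\mathcal{H}$ be a continuous linear self-adjoint operator, let $T_1,\dots,T_m:\mathcal{H}\to\mathcal{H}$ be positive semidefinite continuous linear self-adjoint operators, and let $c,c_1,\dots,c_m\in\mathcal{H}$, $\alpha_1,\dots,\alpha_m\in\mathbb{R}$. Put $f(x)=\frac12\langle x,Tx\rangle+\langle c,x\rangle$, $g_i(x)=\frac12\langle x,T_ix\rangle+\langle c_i,x\rangle+\alpha_i$ and $F=\{x\in\mathcal{H}\mid g_i(x)\leqslant 0,\ i=1,\dots,m\}$. Suppose that $\langle x,Tx\rangle$ is a Legendre form and that: (i) $F$ is nonempty; (ii) if $v\in 0^+F$ then $\langle v,Tv\rangle\geqslant 0$; (iii) if $v\in 0^+F$ and $x\in F$ are such that $\langle v,Tv\rangle=0$, then $\langle Tx+c,v\rangle\geqslant 0$; (iv) condition (A) holds: for every $v\in 0^+F$ with $\langle v,Tv\rangle=0$ one has $\langle c_i,v\rangle=0$ for all $i\in I_1$, where $I_1=\{i\in\{1,\dots,m\}\mid T_i\neq 0\}$ (the condition being vacuously satisfied if $I_1=\emptyset$). Then the problem of minimizing $f(x)$ subject to $x\in F$ has a solution, i.e. there is $\bar x\in F$ with $f(\bar x)\leqslant f(x)$ for all $x\in F$.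
   Context: A continuous linear self-adjoint operator $S$ on $\mathcal{H}$ is positive semidefinite if $\langle x,Sx\rangle\geqslant 0$ for all $x\in\mathcal{H}$. A continuous quadratic form $Q(x)=\langle x,Tx\rangle$ on $\mathcal{H}$ is a Legendre form if (a) $Q$ is weakly lower semicontinuous, and (b) $x_k\to x_0$ strongly whenever $x_k\rightharpoonup x_0$ (weak convergence) and $Q(x_k)\to Q(x_0)$. The recession cone of a nonempty closed convex set $X\subset\mathcal{H}$ is $0^+X=\{v\in\mathcal{H}\mid x+tv\in X\ \ \forall x\in X,\ \forall t\geqslant 0\}$. *)

(* Defs.v *)
From HB Require Import structures.
From mathcomp Require Import all_boot all_order all_algebra.
From mathcomp Require Import all_classical all_reals all_analysis.

Set Implicit Arguments.
Unset Strict Implicit.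
Unset Printing Implicit Defensive.

Import Order.TTheory GRing.Theory Num.Theory.
Import numFieldNormedType.Exports.

Local Open Scope classical_set_scope.
Local Open Scope ring_scope.

(* A real Hilbert space is a complete normed module [H] together with a positive
   definite symmetric bilinear form [dot : {dot H for idfun}] inducing its norm,
   that is, such that [norm_induced_by dot]. *)

Section HilbertSpace.
Context {R : realType} {H : completeNormedModType R}.
Variable dot : {dot H for idfun}.

Definition norm_induced_by : Prop := forall x : H, `|x| = Num.sqrt (dot x x).

Definition self_adjoint (S : H -> H) : Prop :=
  forall x y : H, dot (S x) y = dot x (S y).

Definition positive_semidefinite (S : H -> H) : Prop :=
  forall x : H, 0 <= dot x (S x).

Definition weakly_cvg (x : nat -> H) (l : H) : Prop :=
  forall y : H, dot y (x k) @[k --> \oo] --> dot y l.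

Definition continuous_quadratic_form (Q : H -> R) : Prop :=
  exists T : {linear H -> H},
    [/\ continuous T, self_adjoint T & forall x, Q x = dot x (T x)].

(* Lower semicontinuity along weakly convergent sequences. This is implied by
   lower semicontinuity for the weak topology. *)
Definition weakly_lower_semicontinuous (Q : H -> R) : Prop :=
  forall (x : nat -> H) (l : H), weakly_cvg x l ->
    ((Q l)%:E <= limn_einf (fun k => (Q (x k))%:E))%E.

Definition legendre_form (Q : H -> R) : Prop :=
  [/\ continuous_quadratic_form Q,
      weakly_lower_semicontinuous Q &
      forall (x : nat -> H) (l : H), weakly_cvg x l ->
        Q (x k) @[k --> \oo] --> Q l -> x k @[k --> \oo] --> l].

Definition quadratic_fun (T : H -> H) (c : H) (alpha : R) (x : H) : R :=
  2^-1 * dot x (T x) + dot c x + alpha.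

Definition feasible_set (m : nat) (Ti : 'I_m -> {linear H -> H})
    (ci : 'I_m -> H) (alpha : 'I_m -> R) : set H :=
  [set x | forall i, quadratic_fun (Ti i) (ci i) (alpha i) x <= 0].

End HilbertSpace.

Definition recession_cone {R : realType} {H : normedModType R} (X : set H) :
    set H :=
  [set v | forall (x : H) (t : R), X x -> 0 <= t -> X (x + t *: v)].

Definition nonzero_indices {R : realType} {H : normedModType R} (m : nat)
    (Ti : 'I_m -> {linear H -> H}) : set 'I_m :=
  [set i | (Ti i : H -> H) <> (fun=> 0)].

Definition condition_A {R : realType} {H : completeNormedModType R}
    (dot : {dot H for idfun}) (m : nat) (T : H -> H)
    (Ti : 'I_m -> {linear H -> H}) (ci : 'I_m -> H) (F : set H) : Prop :=
  forall v : H, recession_cone F v -> dot v (T v) = 0 ->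
    forall i : 'I_m, nonzero_indices Ti i -> dot (ci i) v = 0.

(* Main.v *)
Require Import Defs.
From HB Require Import structures.
From mathcomp Require Import all_boot all_order all_algebra.
From mathcomp Require Import all_classical all_reals all_analysis.
From mathcomp Require Import ring lra.

(** The idea is to reduce the problem to the behaviour of feasible points that
    are as short as possible for their objective value.  Call [y] in [F] of
    least norm when every feasible [z] with [f z <= f y] is at least as long.

    Bounded closed convex sets are weakly sequentially compact, [f] is weakly
    lower semicontinuous because the quadratic part is a Legendre form, and
    [F] is weakly closed because the [Ti i] are positive semidefinite.  So below
    every feasible point there is a point of least norm (minimise the norm on
    a sublevel set, [norm_least_below_exists]); and if the points of least norm
    stay in a ball, minimising [f] on the part of [F] in this ball solves the
    problem ([min_of_bounded_norm_least]).

    Suppose then that points [y n] of least norm have norms tending to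
    infinity.  Along a subsequence the directions [y n / |y n|] converge weakly
    to some [v], which is a recession direction of [F].  Dividing the bound on
    [f (y n)] by [|y n|^2] gives [dot v (T v) <= 0], hence equality by
    hypothesis; the Legendre property then makes the convergence strong, so
    that [|v| = 1] and in particular [v != 0] ([asymptotic_direction]).  Now
    compare [y n] with [y n - v] for [n] large.
    - The objective has not increased: its change is
      [- dot (T (y n) + c) v <= 0].
    - The point is still feasible: [Ti i v = 0] for all [i] since [v] is a
      recession direction, so [g_i] changes by [- dot (ci i) v >= 0].  This is
      zero for the truly quadratic constraints by condition (A); for an affine
      constraint with nonzero change, [g_i (y n)] tends to minus infinity.
    - The norm has decreased, as [dot (y n) v] tends to infinity.
    This contradicts the choice of [y n].

    Weak sequential compactness is obtained in [bounded_weak_subsequence], from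
    the Riesz representation theorem on closed subspaces
    ([riesz_subspace]). *)

Set Implicit Arguments.
Unset Strict Implicit.
Unset Printing Implicit Defensive.

Import Order.TTheory GRing.Theory Num.Theory.
Import numFieldNormedType.Exports.
Local Open Scope classical_set_scope.
Local Open Scope ring_scope.

(** * Quadratic polynomials in one variable *)

Lemma ge0_quadratic_disc (R : realFieldType) (a b c : R) :
  (forall t, 0 <= a + 2 * b * t + c * t ^+ 2) -> b ^+ 2 <= a * c.
Proof.
move=> h; have a0 : 0 <= a by have := h 0; rewrite mulr0 expr0n/= mulr0 !addr0.
have [c0|c0|c0] := ltgtP c 0.
- (* at a large [t] and at its opposite, the quadratic term dominates *)
  pose t := a / - c + 1.
  have ct : c * t = c - a by rewrite /t; field; rewrite lt_eqF.
  have t1 : 1 <= t by rewrite lerDr divr_ge0// oppr_ge0 ltW.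
  have := h t; have := h (- t); nra.
- (* the minimum of the polynomial *)
  have := h (- b / c).
  have -> : a + 2 * b * (- b / c) + c * (- b / c) ^+ 2 = (a * c - b ^+ 2) / c.
    by field; rewrite gt_eqF.
  by rewrite pmulr_lge0 ?invr_gt0// subr_ge0.
- subst c; rewrite mulr0; have [->|b0] := eqVneq b 0; first by rewrite expr0n.
  have := h (- (a + 1) / (2 * b)).
  set t := _ / _.
  have -> : a + 2 * b * t + 0 * t ^+ 2 = -1.
    by rewrite /t; field.
  by rewrite ler0N1.
Qed.

Lemma quadratic_bounded_above (R : realFieldType) (a b c : R) :
  (forall t, 0 <= t -> a + b * t + c * t ^+ 2 <= 0) ->
  c <= 0 /\ (c = 0 -> b <= 0).
Proof.
move=> h; split=> [|c0]; rewrite leNgt; apply/negP => pos.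
  (* for [t >= 1] the lower order terms are at least [- (|a| + |b|) * t], and
     this [t] makes [c * t] exceed [|a| + |b|] *)
  pose t := (`|a| + `|b|) / c + 1.
  have ct : c * t = `|a| + `|b| + c by rewrite /t; field; rewrite gt_eqF.
  have t1 : 1 <= t by rewrite lerDr divr_ge0 ?addr_ge0// ltW.
  have := h t (le_trans ler01 t1).
  have := ler_norm (- a); have := ler_norm (- b); rewrite !normrN.
  have := normr_ge0 a; have := normr_ge0 b; nra.
have := h ((`|a| + 1) / b) (divr_ge0 (addr_ge0 (normr_ge0 a) ler01) (ltW pos)).
rewrite c0 mul0r addr0 mulrC divfK ?gt_eqF//.
by have := ler_norm (- a); rewrite normrN; lra.
Qed.

(** * Inner product and continuity *)

Section Dot.
Context {R : realType} {H : completeNormedModType R}.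
Variable dot : {dot H for idfun}.

Lemma dotC x y : dot x y = dot y x.
Proof. by rewrite hermC /= expr0 mul1r. Qed.

Lemma dotDr x y z : dot x (y + z) = dot x y + dot x z.
Proof. exact: linearDr. Qed.

Lemma dotZr a x y : dot x (a *: y) = a * dot x y.
Proof. exact: linearZr_LR. Qed.

Lemma dotNr x y : dot x (- y) = - dot x y.
Proof. exact: linearNr. Qed.

Lemma dotDl x y z : dot (x + y) z = dot x z + dot y z.
Proof. exact: linearDl. Qed.

Lemma dotZl a x y : dot (a *: x) y = a * dot x y.
Proof. exact: linearZl_LR. Qed.

Lemma dotNl x y : dot (- x) y = - dot x y.
Proof. exact: linearNl. Qed.

Definition dotE := (dotDl, dotDr, dotZl, dotZr, dotNl, dotNr).

Lemma dot_ge0 x : 0 <= dot x x.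
Proof.
have [->|x0] := eqVneq x 0; first by rewrite linear0r.
exact/ltW/neq0_dnorm_gt0.
Qed.

Hypothesis dot_norm : norm_induced_by dot.

Lemma dot_sqr_norm x : dot x x = `|x| ^+ 2.
Proof. by rewrite dot_norm sqr_sqrtr// dot_ge0. Qed.

(** The discriminant of [t |-> dot (x + t y) (x + t y) >= 0]. *)
Lemma cauchy_schwarz x y : `|dot x y| <= `|x| * `|y|.
Proof.
rewrite -(@ler_pXn2r _ 2)// ?nnegrE ?mulr_ge0// real_normK ?num_real//.
rewrite exprMn -!dot_sqr_norm; apply: ge0_quadratic_disc => t.
have := dot_ge0 (x + t *: y); rewrite !dotE (dotC y x).
by move=> h; apply: le_trans h _; lra.
Qed.

Lemma continuous_dotr x : continuous (dot x).
Proof.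
move=> y; apply/cvgrPdist_le => e e0.
have d0 : 0 < e / (`|x| + 1) by rewrite divr_gt0// ltr_wpDl.
apply: filterS (nbhs_ball_norm y (PosNum d0)) => z /= zy.
rewrite -dotNr -dotDr (le_trans (cauchy_schwarz _ _))//.
have /ltW := zy; rewrite ler_pdivlMr ?ltr_wpDl//.
have := normr_ge0 x; have := normr_ge0 (y - z); nra.
Qed.

End Dot.

(** * Weak sequential compactness of bounded sets *)

(** An ultrafilter converges to each of its cluster points, and a filter on a
    compact set has one. *)
Lemma ultra_cvg_compact (T : Type) (V : topologicalType) (G : set_system T)
    (f : T -> V) (K : set V) :
  UltraFilter G -> compact K -> (forall t, K (f t)) ->
  exists p : V, f @ G --> p.
Proof.
move=> GU cK Kf.
have GP : ProperFilter (f @ G) by apply: fmap_proper_filter.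
have [p [_ clp]] := cK (f @ G) GP (filterS (fun t _ => Kf t) filterT).
exists p => U pU.
have [//|nU] := in_ultra_setVsetC (f @^-1` U) GU.
by have [q []] := clp _ _ (nU : (f @ G) (~` U)) pU.
Qed.

Section Weak.
Context {R : realType} {H : completeNormedModType R}.
Variable dot : {dot H for idfun}.
Hypothesis dot_norm : norm_induced_by dot.

(** Riesz representation on a closed subspace [W].  The representing vector is
    the minimiser over [W] of [J x = |x|^2 - 2 L x]; a minimising sequence is
    Cauchy by the parallelogram identity, since the midpoint of two of its
    terms cannot do better than the infimum.  With [L = dot y] this is the
    orthogonal projection of [y] on [W]. *)
Lemma riesz_subspace (W : set H) (L : H -> R) (M : R) :
  W 0 -> (forall a x y, W x -> W y -> W (x + a *: y)) -> closed W ->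
  (forall a x y, L (x + a *: y) = L x + a * L y) ->
  (forall x, `|L x| <= M * `|x|) ->
  exists2 p, W p & forall w, W w -> dot p w = L w.
Proof.
move=> W0 Wlin Wcl Llin LM.
pose J x := dot x x - 2 * L x.
have Jexp x w t : J (x + t *: w) =
    J x + 2 * (dot x w - L w) * t + dot w w * t ^+ 2.
  by rewrite /J Llin !dotE (dotC dot w x); ring.
have Jlb x : - M ^+ 2 <= J x.
  rewrite /J (dot_sqr_norm dot_norm); have := LM x; have := ler_norm (L x).
  have := sqr_ge0 (M - `|x|).
  by nra.
have Jinf : has_inf (J @` W).
  split; first by exists (J 0), 0.
  by exists (- M ^+ 2) => _ [x _ <-].
pose i := inf (J @` W).
have iJ w : W w -> i <= J w.
  by move=> Ww; apply: ge_inf; [case: Jinf | exists w].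
have /choice[u uP] : forall n, exists w, W w /\ J w < i + n.+1%:R^-1.
  move=> n; have n0 : (0 : R) < n.+1%:R^-1 by rewrite invr_gt0.
  by have [_ [w Ww <-] wi] := inf_adherent n0 Jinf; exists w.
(* parallelogram identity, with midpoint [u n + 2^-1 *: (w - u n)] *)
have mid n w : W w -> `|u n - w| ^+ 2 <= 2 * (n.+1%:R^-1 + (J w - i)).
  move=> Ww; have [Wu ui] := uP n.
  have Wd : W (w + (-1) *: u n) by apply: Wlin.
  have := Jexp (u n) (w + (-1) *: u n) 1.
  rewrite !scale1r scaleN1r addrCA subrr addr0 => E1.
  have := iJ _ (Wlin 2^-1 _ _ Wu Wd); rewrite Jexp scaleN1r.
  rewrite distrC -(dot_sqr_norm dot_norm); move: E1.
  set b := dot (u n) _ - _; set c := dot _ _.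
  rewrite expr1n !mulr1; move: (J (u n)) (J w) (n.+1%:R^-1) ui => ju jw e ui.
  have -> : (2^-1 : R) ^+ 2 = 4^-1 by field.
  clearbody b c i; clear - ui; lra.
have uC : cauchy (u @ \oo).
  apply: cauchy_exP => e e0.
  have d0 : 0 < e ^+ 2 / 4 by rewrite divr_gt0// exprn_gt0.
  have [N _ NP] := near_infty_natSinv_lt (PosNum d0).
  exists (u N); exists N => // n /= Nn.
  rewrite -ball_normE /= -(@ltr_pXn2r _ 2) ?nnegrE// ?ltW//.
  have := mid N _ (uP n).1; have := (uP n).2.
  have /= := NP N (leqnn _); have /= := NP n Nn.
  move: (J (u n)) (N.+1%:R^-1) (n.+1%:R^-1) => jn eN en.
  by lra.
have /cauchy_cvgP/cvg_ex[p up] := uC.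
have Wp : W p.
  by apply: (closed_cvg _ Wcl _ _ up); apply: nearW => n; case: (uP n).
exists p => // w Ww.
have dcvg : (dot (u n) w - L w) ^+ 2 @[n --> \oo] --> (dot p w - L w) ^+ 2.
  rewrite expr2; under eq_fun do rewrite expr2.
  have h : dot (u n) w - L w @[n --> \oo] --> dot p w - L w.
    apply: cvgB; last exact: cvg_cst.
    under eq_fun do rewrite dotC; rewrite dotC.
    by apply: (continuous_cvg _ _ up); apply: continuous_dotr.
  exact: cvgM.
(* [u n] is an approximate minimiser along the line of direction [w]: the
   discriminant of [J (u n + t *: w) - inf J + n.+1%:R^-1 >= 0] bounds the
   derivative of [J] there *)
have : (dot p w - L w) ^+ 2 <= 0.
  have e0 : n.+1%:R^-1 * dot w w @[n --> \oo] --> 0 * dot w w.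
    by apply: cvgMl; exact: cvg_harmonic.
  rewrite -(mul0r (dot w w)).
  apply: (ler_cvg_to dcvg e0); apply: nearW => n.
  apply: ge0_quadratic_disc => t; have := (uP n).2.
  have := iJ _ (Wlin t _ _ (uP n).1 Ww); rewrite Jexp.
  move: (J (u n)) (n.+1%:R^-1) => jn en.
  by lra.
by rewrite real_exprn_even_le0 ?num_real//= subr_eq0 => /eqP.
Qed.

(** The candidate limit [l] represents the functional that sends [y] to the
    limit of [dot y (x n)] along an ultrafilter.  A diagonal choice only gives a
    subsequence with this limit for countably many [y]; those taken are the
    [x m].  The set [W] of the [y] for which the limit is right is then a closed
    subspace that contains every [x m].  Replacing an arbitrary [y] by its
    projection on [W] changes neither [dot y (x n)] nor [dot y l], so [W] is
    everything.

    Indices satisfy [n <= phi n], not strict monotonicity: this suffices for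
    every limit at infinity. *)
Lemma bounded_weak_subsequence (x : nat -> H) (M : R) :
  (forall n, `|x n| <= M) ->
  exists phi : nat -> nat, exists2 l, (forall n, (n <= phi n)%N) &
    weakly_cvg dot (x \o phi) l.
Proof.
move=> xM.
have [G [GU Goo]] := ultraFilterLemma (F := \oo) _.
have /choice[L Lcvg] : forall y, exists r : R, dot y (x n) @[n --> G] --> r.
  move=> y; apply: (ultra_cvg_compact _
    (@segment_compact _ (- (M * `|y|)) (M * `|y|))) => n /=.
  rewrite in_itv/= -ler_norml (le_trans (cauchy_schwarz dot_norm _ _))//.
  by rewrite mulrC ler_wpM2r.
have Llin a y z : L (y + a *: z) = L y + a * L z.
  have : dot (y + a *: z) (x n) @[n --> G] --> L y + a * L z.
    under eq_fun do rewrite dotDl dotZl.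
    by apply: cvgD => //; apply: cvgMr.
  exact: (cvg_unique (@Rhausdorff R) (Lcvg _)).
have LM y : `|L y| <= M * `|y|.
  apply: (ler_cvg_to (cvg_norm (Lcvg y)) (cvg_cst (M * `|y|))).
  apply: nearW => n.
  by rewrite (le_trans (cauchy_schwarz dot_norm _ _))// mulrC ler_wpM2r.
have [l _ lP] :=
  @riesz_subspace setT L M I (fun _ _ _ _ _ => I) closedT Llin LM.
have /choice[phi phiP] : forall k, exists n, (k <= n)%N /\
    forall m, (m <= k)%N -> `|dot (x m) l - dot (x m) (x n)| < k.+1%:R^-1.
  move=> k; have GF : Filter G by typeclasses eauto.
  have k0 : (0 : R) < k.+1%:R^-1 by rewrite invr_gt0.
  have h1 : \forall n \near G, forall m : 'I_k.+1,
      `|dot (x m) l - dot (x m) (x n)| < k.+1%:R^-1.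
    apply: filter_forall => m; rewrite dotC lP//.
    by have /cvgrPdist_lt := Lcvg (x m); apply.
  have h2 : \forall n \near G, (k <= n)%N by apply: Goo; exact: nbhs_infty_ge.
  have [n [hn kn]] := filter_ex (filterI h1 h2).
  by exists n; split => // m mk; apply: (hn (Ordinal (mk : (m < k.+1)%N))).
exists phi, l; first by move=> n; case: (phiP n).
pose W := [set y | dot y (x (phi k)) @[k --> \oo] --> dot y l].
have Wx m : W (x m).
  apply/cvgrPdist_lt => e e0.
  near=> k; apply: (@lt_trans _ _ k.+1%:R^-1).
    by apply: (phiP k).2; near: k; exact: nbhs_infty_ge.
  by near: k; exact: (near_infty_natSinv_lt (PosNum e0)).
have Wlin a y z : W y -> W z -> W (y + a *: z).
  move=> Wy Wz; rewrite /W /=; under eq_fun do rewrite dotDl dotZl.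
  by rewrite dotDl dotZl; apply: cvgD => //; apply: cvgMr.
have W0 : W 0 by rewrite -(subrr (x 0%N)) -scaleN1r; apply: Wlin.
have Wcl : closed W.
  move=> y clWy; apply/cvgrPdist_lt => e e0.
  have K0 : 0 < M + `|l| + 1.
    by have := le_trans (normr_ge0 _) (xM 0%N); have := normr_ge0 l; lra.
  have d0 : 0 < e / 2 / (M + `|l| + 1) by rewrite !divr_gt0.
  have [z [Wz yz]] := clWy _ (nbhsx_ballx y _ d0).
  have e20 : 0 < e / 2 by rewrite divr_gt0.
  have /cvgrPdist_lt/(_ _ e20) : dot z (x (phi k)) @[k --> \oo] --> dot z l.
    exact: Wz.
  apply: filterS => k zk.
  have -> : dot y l - dot y (x (phi k)) =
      dot (y - z) (l - x (phi k)) + (dot z l - dot z (x (phi k))).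
    by rewrite !dotE; ring.
  rewrite (le_lt_trans (ler_normD _ _))// [ltRHS](splitr e) ler_ltD//.
  rewrite (le_trans (cauchy_schwarz dot_norm _ _))//.
  move: yz; rewrite -ball_normE/= ltr_pdivlMr// => /ltW; apply: le_trans.
  rewrite ler_wpM2l// (le_trans (ler_normB _ _))//.
  by have := xM (phi k); lra.
move=> y.
have [p Wp pP] := @riesz_subspace W (dot y) `|y| W0 Wlin Wcl
  (fun a z w => etrans (dotDr dot y z _) (congr1 _ (dotZr dot a y w)))
  (cauchy_schwarz dot_norm y).
(* limits along [G] of sequences that agree, since [x n] is in [W] *)
have -> : dot y l = dot p l.
  rewrite dotC (dotC dot p) !lP//.
  apply: (cvg_unique (@Rhausdorff R) (Lcvg y)); have := Lcvg p.
  by under eq_fun do rewrite pP//.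
by have := Wp; rewrite /W/=; under eq_fun do rewrite pP//.
Unshelve. all: by end_near. Qed.

End Weak.

(** * Weak lower semicontinuity and minimisation *)

Section Min.
Context {R : realType} {H : completeNormedModType R}.
Variable dot : {dot H for idfun}.
Hypothesis dot_norm : norm_induced_by dot.

(** Weak sequential lower semicontinuity.  Bounding [h (x n)] by a convergent
    sequence instead of taking a limit inferior keeps the values real, and
    lets terms with known limits be moved to the bound. *)
Definition wlsc (h : H -> R) : Prop :=
  forall (x : nat -> H) (l : H) (b : nat -> R) (beta : R),
    weakly_cvg dot x l -> b n @[n --> \oo] --> beta ->
    (\forall n \near \oo, h (x n) <= b n) -> h l <= beta.

Definition weakly_seq_closed (C : set H) : Prop :=
  forall (x : nat -> H) (l : H), weakly_cvg dot x l ->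
    (\forall n \near \oo, C (x n)) -> C l.

Lemma weakly_seq_closedI C D : weakly_seq_closed C -> weakly_seq_closed D ->
  weakly_seq_closed (C `&` D).
Proof.
move=> cC cD x l xl CDx; split.
  by apply: (cC x) => //; apply: filterS CDx => n [].
by apply: (cD x) => //; apply: filterS CDx => n [].
Qed.

Lemma wlsc_sublevel_closed h beta :
  wlsc h -> weakly_seq_closed [set x | h x <= beta].
Proof. by move=> hh x l xl hx; apply: (hh x l _ beta xl (cvg_cst beta)). Qed.

(** The direct method.  A sequence on which [h] tends to minus infinity, or to
    its infimum, has a weakly convergent subsequence; its limit excludes the
    former and attains the latter. *)
Lemma wlsc_attains_min (C : set H) (h : H -> R) (M : R) :
  C !=set0 -> weakly_seq_closed C -> (forall x, C x -> `|x| <= M) -> wlsc h ->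
  exists2 x, C x & forall z, C z -> h x <= h z.
Proof.
move=> [x0 Cx0] cC CM hh.
have wsub (u : nat -> H) : (forall n, C (u n)) -> exists phi : nat -> nat,
    exists l, [/\ forall n, (n <= phi n)%N, weakly_cvg dot (u \o phi) l & C l].
  move=> Cu.
  have [phi [l nphi wl]] :=
    bounded_weak_subsequence dot_norm (fun n => CM _ (Cu n)).
  exists phi, l; split => //; apply: (cC _ _ wl).
  by apply: nearW => n; exact: Cu.
have hlb : has_lbound (h @` C).
  apply: contrapT => nlb.
  have /choice[u uP] : forall n : nat, exists x, C x /\ h x < - n%:R.
    move=> n; apply: contrapT => nx; apply: nlb; exists (- n%:R) => _ [x Cx <-].
    by rewrite leNgt; apply/negP => hx; apply: nx; exists x.
  have [phi [l [nphi wl Cl]]] := wsub u (fun n => (uP n).1).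
  have : h l <= h l - 1.
    apply: (hh _ _ _ _ wl (cvg_cst _)); near=> n => /=.
    apply: (le_trans (ltW (uP (phi n)).2)); rewrite lerNl.
    apply: (@le_trans _ _ n%:R); last by rewrite ler_nat.
    by near: n; exact: nbhs_infty_ger.
  by rewrite lerBrDr gerDl ler10.
have hinf : has_inf (h @` C) by split => //; exists (h x0), x0.
have /choice[u uP] : forall n : nat, exists x,
    C x /\ h x < inf (h @` C) + n.+1%:R^-1.
  move=> n; have n0 : (0 : R) < n.+1%:R^-1 by rewrite invr_gt0.
  by have [_ [x Cx <-] hx] := inf_adherent n0 hinf; exists x.
have [phi [l [nphi wl Cl]]] := wsub u (fun n => (uP n).1).
exists l => // z Cz; apply: le_trans (ge_inf hlb _); last by exists z.
have lim_b : inf (h @` C) + n.+1%:R^-1 @[n --> \oo] --> inf (h @` C) + 0.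
  by apply: cvgD; [exact: cvg_cst | exact: cvg_harmonic].
rewrite -[leRHS]addr0; apply: (hh _ _ _ _ wl lim_b); apply: nearW => n /=.
apply: (le_trans (ltW (uP (phi n)).2)); rewrite lerD2l lef_pV2 ?posrE//.
by rewrite ler_nat ltnS.
Unshelve. all: by end_near. Qed.

(** A convex quadratic form lies above its tangent at [l], which is weakly
    continuous. *)
Lemma wlsc_psd (S : {linear H -> H}) : self_adjoint dot S ->
  positive_semidefinite dot S -> wlsc (fun x => dot x (S x)).
Proof.
move=> Ssa Spsd x l b beta xl bb hx.
have blim : b n - 2 * (dot (S l) (x n) - dot (S l) l) @[n --> \oo] -->
    beta - 2 * (dot (S l) l - dot (S l) l).
  apply: cvgB => //; apply: cvgMr; apply: cvgB; [exact: xl | exact: cvg_cst].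
rewrite subrr mulr0 subr0 in blim.
apply: (ler_cvg_to (cvg_cst (dot l (S l))) blim); apply: filterS hx => n hx.
have := Spsd (x n - l); rewrite linearB !dotE.
rewrite (dotC dot (x n) (S l)) -(Ssa l (x n)) (dotC dot l (S l)).
by lra.
Qed.

Lemma wlsc_weakly_lower_semicontinuous (Q : H -> R) :
  weakly_lower_semicontinuous dot Q -> wlsc Q.
Proof.
move=> Qlsc x l b beta xl bb hx.
rewrite -lee_fin (le_trans (Qlsc _ _ xl))// limn_einf_lim.
have bE : (b n)%:E @[n --> \oo] --> beta%:E.
  by apply/cvg_EFin => //; exact: nearW.
rewrite -(cvg_lim _ bE)//; apply: lee_lim.
- exact: is_cvg_einfs.
- by apply/cvg_ex; eexists; exact: bE.
- apply: filterS hx => n hx.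
  apply: (@le_trans _ _ (Q (x n))%:E); last by rewrite lee_fin.
  by apply: ereal_inf_lbound; exists n => //=.
Qed.

Lemma wlsc_quadratic_fun (S : H -> H) c alpha :
  wlsc (fun x => dot x (S x)) -> wlsc (quadratic_fun dot S c alpha).
Proof.
move=> hS x l b beta xl bb hx.
have blim : 2 * (b n - dot c (x n) - alpha) @[n --> \oo] -->
    2 * (beta - dot c l - alpha).
  by apply: cvgMr; apply: cvgB; [apply: cvgB => //; exact: xl | exact: cvg_cst].
have : dot l (S l) <= 2 * (beta - dot c l - alpha).
  apply: (hS _ _ _ _ xl blim); apply: filterS hx => n.
  by rewrite /quadratic_fun; lra.
by rewrite /quadratic_fun; lra.
Qed.

Lemma wlsc_norm_sqr : wlsc (fun x => `|x| ^+ 2).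
Proof.
have -> : (fun x : H => `|x| ^+ 2) = (fun x => dot x (idfun x)).
  by apply/funext => x; rewrite dot_sqr_norm.
by apply: wlsc_psd => [x y|x] //; exact: dot_ge0.
Qed.

Lemma weakly_seq_closed_ball M :
  0 <= M -> weakly_seq_closed [set x | `|x| <= M].
Proof.
move=> M0; have -> : [set x : H | `|x| <= M] = [set x | `|x| ^+ 2 <= M ^+ 2].
  by apply/seteqP; split => x /=; rewrite ler_sqr ?nnegrE.
exact/wlsc_sublevel_closed/wlsc_norm_sqr.
Qed.

Lemma quadratic_funD (S : {linear H -> H}) c alpha x v t : self_adjoint dot S ->
  quadratic_fun dot S c alpha (x + t *: v) = quadratic_fun dot S c alpha x +
    t * dot (S x + c) v + 2^-1 * t ^+ 2 * dot v (S v).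
Proof.
move=> Ssa; rewrite /quadratic_fun linearD linearZ/= !dotE -(Ssa x v).
by rewrite (dotC dot v (S x)); field.
Qed.

End Min.

(** * Recession directions *)

Section Recession.
Context {R : realType} {H : completeNormedModType R}.
Variable dot : {dot H for idfun}.
Hypothesis dot_norm : norm_induced_by dot.

Lemma weakly_cvg_subseq (x : nat -> H) l (phi : nat -> nat) :
  (forall n, (n <= phi n)%N) -> weakly_cvg dot x l ->
  weakly_cvg dot (x \o phi) l.
Proof.
move=> nphi xl y; apply: (cvg_comp phi (fun n => dot y (x n))) (xl y).
move=> A [N _ NA]; exists N => // n /= Nn.
by apply: NA => /=; apply: leq_trans (nphi n).
Qed.

(** Lower semicontinuity supplies the lower bound.  It is applied along a
    subsequence on which [Q (x n)] would stay below [Q l - e]. *)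
Lemma wlsc_cvg (Q : H -> R) (x : nat -> H) l (b : nat -> R) :
  wlsc dot Q -> weakly_cvg dot x l -> b n @[n --> \oo] --> Q l ->
  (forall n, Q (x n) <= b n) -> Q (x n) @[n --> \oo] --> Q l.
Proof.
move=> hQ xl bb hb; apply/cvgrPdist_lt => e e0.
have lower : \forall n \near \oo, Q l - e < Q (x n).
  apply: contrapT => nlow.
  have /choice[phi phiP] : forall N, exists n, (N <= n)%N /\ Q (x n) <= Q l - e.
    move=> N; apply: contrapT => nn; apply: nlow; exists N => // n /= Nn.
    by rewrite ltNge; apply/negP => hn; apply: nn; exists n.
  have Qphi : \forall n \near \oo, Q ((x \o phi) n) <= Q l - e.
    by apply: nearW => n; case: (phiP n).
  have : Q l <= Q l - e.
    apply: (hQ _ _ _ _ (weakly_cvg_subseq _ xl) (cvg_cst _) Qphi) => n.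
    by case: (phiP n).
  by rewrite lerBrDr gerDl leNgt e0.
have upper : \forall n \near \oo, b n < Q l + e.
  by apply: (cvgr_lt _ bb); rewrite ltrDl.
near=> n; rewrite distrC ltr_distl; apply/andP; split; first by near: n.
by apply: le_lt_trans (hb n) _; near: n.
Unshelve. all: by end_near. Qed.

(** The Cauchy-Schwarz inequality for the semidefinite form [dot x (S y)], at
    [x = S v] and [y = v]. *)
Lemma psd_kernel (S : {linear H -> H}) v : self_adjoint dot S ->
  positive_semidefinite dot S -> dot v (S v) = 0 -> S v = 0.
Proof.
move=> Ssa Spsd Sv0.
have : dot (S v) (S v) ^+ 2 <= dot (S v) (S (S v)) * 0.
  apply: ge0_quadratic_disc => t; have := Spsd (S v + t *: v).
  rewrite linearD linearZ/= !dotE Sv0 -(Ssa v (S v)) => h; apply: le_trans h _.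
  by lra.
rewrite mulr0 real_exprn_even_le0 ?num_real//= dot_sqr_norm//.
by rewrite sqrf_eq0 normr_eq0 => /eqP.
Qed.

(** For [x] in [F], the point [x + t v] is the weak limit of the convex
    combinations [x + t r_n (y_n - x)]. *)
Lemma recession_weak_limit (F : set H) (y : nat -> H) (r : nat -> R) v :
  (forall x z s, F x -> F z -> 0 <= s <= 1 -> F (x + s *: (z - x))) ->
  weakly_seq_closed dot F -> (forall n, F (y n)) ->
  (forall n, 0 <= r n) -> r n @[n --> \oo] --> 0 ->
  weakly_cvg dot (fun n => r n *: y n) v -> recession_cone F v.
Proof.
move=> Fconv Fcl Fy r0 rcvg rv x t Fx t0.
have tr : t * r n @[n --> \oo] --> 0 by rewrite -(mulr0 t); apply: cvgMr.
apply: (Fcl (fun n => x + (t * r n) *: (y n - x))).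
  move=> w; rewrite !dotE.
  have -> : dot w x + t * dot w v = dot w x + (t * dot w v - 0 * dot w x).
    by rewrite mul0r subr0.
  rewrite (_ : (fun n => _) = (fun n => dot w x +
      (t * dot w (r n *: y n) - t * r n * dot w x))).
    apply: cvgD; first exact: cvg_cst.
    by apply: cvgB; [apply: cvgMr; exact: rv | apply: cvgMl].
  by apply/funext => n; rewrite !dotE; ring.
near=> n; apply: Fconv => //; rewrite mulr_ge0//=.
by near: n; apply: (cvgr_le _ tr).
Unshelve. all: by end_near. Qed.

Section Feasible.
Variables (m : nat) (Ti : 'I_m -> {linear H -> H}).
Hypothesis Ti_sa : forall i, self_adjoint dot (Ti i).
Hypothesis Ti_psd : forall i, positive_semidefinite dot (Ti i).
Variables (ci : 'I_m -> H) (alpha : 'I_m -> R).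
Local Notation F := (feasible_set dot Ti ci alpha).

Lemma feasible_weakly_closed : weakly_seq_closed dot F.
Proof.
move=> x l xl Fx i.
have gi : wlsc dot (quadratic_fun dot (Ti i) (ci i) (alpha i)).
  by apply: wlsc_quadratic_fun; exact: wlsc_psd.
apply: (wlsc_sublevel_closed gi xl); apply: filterS Fx => n; exact.
Qed.

Lemma feasible_convex x z s : F x -> F z -> 0 <= s <= 1 -> F (x + s *: (z - x)).
Proof.
move=> Fx Fz /andP[s0 s1] i; have Fxi := Fx i; have := Fz i.
set d := z - x; have -> : z = x + 1 *: d by rewrite scale1r addrC subrK.
rewrite !quadratic_funD// mul1r expr1n mulr1; have := Ti_psd i d.
move: Fxi; set q := dot _ _; set a := quadratic_fun _ _ _ _ _; set b := dot _ _.
move=> a0 q0 abq.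
have : (1 - s) * a <= 0 by rewrite mulr_ge0_le0// subr_ge0.
have : s * (a + b + 2^-1 * q) <= 0 by rewrite mulr_ge0_le0.
have : 0 <= s * (1 - s) * q by rewrite !mulr_ge0// subr_ge0.
lra.
Qed.

(** Along [x + t v] the constraint [g_i] is a quadratic polynomial in [t] that
    is bounded above, so its leading coefficient [dot v (Ti i v) / 2 >= 0]
    vanishes and its linear coefficient is nonpositive. *)
Lemma feasible_recession x v : F x -> recession_cone F v ->
  forall i, Ti i v = 0 /\ dot (ci i) v <= 0.
Proof.
move=> Fx rv i.
have h t : 0 <= t -> quadratic_fun dot (Ti i) (ci i) (alpha i) x +
    dot (Ti i x + ci i) v * t + 2^-1 * dot v (Ti i v) * t ^+ 2 <= 0.
  move=> t0; have := rv x t Fx t0 i; rewrite quadratic_funD//.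
  by rewrite [t * _]mulrC mulrAC.
have [qle0 ble0] := quadratic_bounded_above h.
have q0 : dot v (Ti i v) = 0.
  apply: le_anti; rewrite Ti_psd andbT.
  by rewrite pmulr_rle0 ?invr_gt0// in qle0.
have Tv0 : Ti i v = 0 by exact: psd_kernel.
split => //; have := ble0; rewrite q0 mulr0 => /(_ erefl).
by rewrite dotDl Ti_sa Tv0 linear0r add0r.
Qed.

End Feasible.
End Recession.

(** * Points of least norm for their objective value *)

Section LeastNorm.
Context {R : realType} {H : completeNormedModType R}.
Variable dot : {dot H for idfun}.
Hypothesis dot_norm : norm_induced_by dot.
Variables (F : set H) (f : H -> R).
Hypotheses (Fcl : weakly_seq_closed dot F) (flsc : wlsc dot f).

Definition norm_least_below (y : H) : Prop :=
  F y /\ forall z, F z -> f z <= f y -> `|y| <= `|z|.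

(** The ball of radius [|x|] only serves to bound the set on which the norm is
    minimised. *)
Lemma norm_least_below_exists x : F x ->
  exists2 y, norm_least_below y & f y <= f x.
Proof.
move=> Fx.
pose C := F `&` [set z | f z <= f x] `&` [set z : H | `|z| <= `|x|].
have C0 : C !=set0 by exists x; split => //=; split => //=.
have Ccl : weakly_seq_closed dot C.
  apply: weakly_seq_closedI; last exact: weakly_seq_closed_ball.
  by apply: weakly_seq_closedI => //; exact: wlsc_sublevel_closed.
have [y [[Fy fy] yx] ymin] := wlsc_attains_min dot_norm C0 Ccl
  (fun z (Cz : C z) => Cz.2) (wlsc_norm_sqr dot_norm).
exists y => //; split => // z Fz fz; have [zx|/ltW xz] := leP `|z| `|x|.
  rewrite -ler_sqr ?nnegrE//; apply: ymin; split => //; split => //=.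
  exact: le_trans fz fy.
exact: le_trans yx xz.
Qed.

(** Minimising [f] on the ball of radius [M] loses nothing, as below every
    point of [F] there is one in this ball. *)
Lemma min_of_bounded_norm_least M : F !=set0 ->
  (forall y, norm_least_below y -> `|y| <= M) ->
  exists2 x, F x & forall z, F z -> f x <= f z.
Proof.
move=> [x0 Fx0] bnd.
have [y0 ly0 _] := norm_least_below_exists Fx0.
pose C := F `&` [set z : H | `|z| <= M].
have C0 : C !=set0 by exists y0; split; [case: ly0 | exact: bnd].
have Ccl : weakly_seq_closed dot C.
  apply: weakly_seq_closedI => //; apply: weakly_seq_closed_ball => //.
  by apply: le_trans (bnd _ ly0).
have [x [Fx _] xmin] := wlsc_attains_min dot_norm C0 Ccl
  (fun z (Cz : C z) => Cz.2) flsc.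
exists x => // z Fz; have [y ly yz] := norm_least_below_exists Fz.
by apply: le_trans yz; apply: xmin; split; [case: ly | exact: bnd].
Qed.

End LeastNorm.

(** * Asymptotic directions of unbounded sublevel sequences *)

Section Asymptotic.
Context {R : realType} {H : completeNormedModType R}.
Variable dot : {dot H for idfun}.
Hypothesis dot_norm : norm_induced_by dot.

(** With [u n = y n / |y n|], the bound on the objective reads
    [dot (u n) (T (u n)) <= b n] where [b n] tends to zero.  The Legendre
    property prevents the unit vectors [u n] from converging weakly to zero. *)
Lemma asymptotic_direction (F : set H) (T : {linear H -> H}) c alpha beta
    (y : nat -> H) :
  (forall x z s, F x -> F z -> 0 <= s <= 1 -> F (x + s *: (z - x))) ->
  weakly_seq_closed dot F -> legendre_form dot (fun x => dot x (T x)) ->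
  (forall v, recession_cone F v -> 0 <= dot v (T v)) ->
  (forall n, F (y n)) -> (forall n, n.+1%:R <= `|y n|) ->
  (forall n, quadratic_fun dot T c alpha (y n) <= beta) ->
  exists phi : nat -> nat, exists v, [/\ forall n, (n <= phi n)%N, v != 0,
    recession_cone F v, dot v (T v) = 0 &
    weakly_cvg dot (fun n => `|y (phi n)|^-1 *: y (phi n)) v].
Proof.
move=> Fconv Fcl [_ Qlsc Qleg] Qrec Fy yn fy.
have {}Qlsc := wlsc_weakly_lower_semicontinuous Qlsc.
have y0 n : 0 < `|y n| by apply: lt_le_trans (yn n).
pose u n := `|y n|^-1 *: y n.
have u1 n : `|u n| = 1.
  by rewrite normrZ normfV normr_id mulVf// gt_eqF.
have [|phi [v nphi uv]] :=
  bounded_weak_subsequence dot_norm (x := u) (M := 1).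
  by move=> n; rewrite u1.
pose r n := `|y (phi n)|^-1.
have rcvg : r n @[n --> \oo] --> 0.
  apply: (squeeze_cvgr _ (cvg_cst 0) (@cvg_harmonic R)); apply: nearW => n.
  rewrite invr_ge0 normr_ge0/= lef_pV2 ?posrE//; apply: le_trans (yn _).
  by rewrite ler_nat ltnS.
have vrec : recession_cone F v.
  apply: (recession_weak_limit Fconv Fcl (fun n => Fy (phi n)) _ rcvg uv) => n.
  by rewrite invr_ge0.
pose b n := 2 * ((beta - alpha) * r n * r n - dot c (u (phi n)) * r n).
have bcvg : b n @[n --> \oo] --> 0.
  have -> : (0 : R) = 2 * ((beta - alpha) * 0 * 0 - dot c v * 0).
    by rewrite !mulr0 subrr mulr0.
  apply: cvgMr; apply: cvgB; last by apply: cvgM => //; exact: uv.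
  by apply: cvgM => //; apply: cvgMr.
have Qb n : dot (u (phi n)) (T (u (phi n))) <= b n.
  rewrite /b /u linearZ/= !dotE -/(r n).
  have rr : 0 <= r n * r n by rewrite mulr_ge0// invr_ge0.
  by have := ler_wpM2l rr (fy (phi n)); rewrite /quadratic_fun; lra.
have Qv0 : dot v (T v) = 0.
  apply: le_anti; rewrite Qrec// andbT.
  by apply: (Qlsc _ _ _ _ uv bcvg); apply: nearW.
have ustrong : (u \o phi) n @[n --> \oo] --> v.
  by apply: Qleg => //; apply: (wlsc_cvg Qlsc uv _ Qb); rewrite Qv0.
exists phi, v; split => //.
rewrite -normr_gt0; apply: (@lt_le_trans _ _ 1) => //.
have := ler_cvg_to (cvg_cst (1 : R)) (cvg_norm ustrong); apply.
apply: nearW => n /=.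
by rewrite u1.
Qed.

Lemma dot_large_along (z : nat -> H) v w K :
  (forall n, n.+1%:R <= `|z n|) ->
  weakly_cvg dot (fun n => `|z n|^-1 *: z n) v ->
  0 < dot w v -> \forall n \near \oo, K <= dot w (z n).
Proof.
move=> zn zv wv.
have half : \forall n \near \oo, dot w v / 2 <= dot w (`|z n|^-1 *: z n).
  by apply: (cvgr_ge _ (zv w)); lra.
near=> n.
have z0 : 0 < `|z n| by apply: lt_le_trans (zn n).
have -> : dot w (z n) = `|z n| * dot w (`|z n|^-1 *: z n).
  by rewrite dotZr mulVKf// gt_eqF.
have nK : K / (dot w v / 2) <= `|z n|.
  apply: le_trans (zn n); apply: (@le_trans _ _ n%:R); last by rewrite ler_nat.
  by near: n; exact: nbhs_infty_ger.
rewrite ler_pdivrMr ?divr_gt0// in nK; apply: le_trans nK _.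
by rewrite ler_pM2l//; near: n.
Unshelve. all: by end_near. Qed.

End Asymptotic.

(** * Existence of a minimiser *)

Theorem theorem3p3 (R : realType) (H : completeNormedModType R)
    (dot : {dot H for idfun}) (dot_norm : norm_induced_by dot)
    (m : nat) (m_gt0 : (0 < m)%N)
    (T : {linear H -> H}) (T_cont : continuous T) (T_sa : self_adjoint dot T)
    (Ti : 'I_m -> {linear H -> H})
    (Ti_cont : forall i, continuous (Ti i))
    (Ti_sa : forall i, self_adjoint dot (Ti i))
    (Ti_psd : forall i, positive_semidefinite dot (Ti i))
    (c : H) (ci : 'I_m -> H) (alpha : 'I_m -> R) :
  let f : H -> R := quadratic_fun dot T c 0 in
  let F : set H := feasible_set dot Ti ci alpha in
  legendre_form dot (fun x => dot x (T x)) ->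
  F !=set0 ->
  (forall v, recession_cone F v -> 0 <= dot v (T v)) ->
  (forall v x, recession_cone F v -> F x -> dot v (T v) = 0 ->
     0 <= dot (T x + c) v) ->
  condition_A dot T Ti ci F ->
  exists2 xbar : H, F xbar & forall x : H, F x -> f xbar <= f x.
Proof.
move=> f F Qleg F0 Qrec grad condA.
have Fcl : weakly_seq_closed dot F by exact: feasible_weakly_closed.
have flsc : wlsc dot f.
  apply/wlsc_quadratic_fun/wlsc_weakly_lower_semicontinuous.
  by case: Qleg.
suff [M bnd] : exists M, forall y, norm_least_below F f y -> `|y| <= M.
  exact: (min_of_bounded_norm_least dot_norm Fcl flsc F0 bnd).
apply: contrapT => unbnd; have [x0 Fx0] := F0.
have /choice[y yP] : forall n : nat, exists y,
    norm_least_below F f y /\ n.+1%:R + `|x0| < `|y|.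
  move=> n; apply: contrapT => ny; apply: unbnd.
  exists (n.+1%:R + `|x0|) => y ly.
  by rewrite leNgt; apply/negP => yn; apply: ny; exists y.
have Fy n : F (y n) by case: (yP n) => -[].
have yn n : n.+1%:R <= `|y n|.
  by apply: le_trans (ltW (yP n).2); rewrite lerDl.
(* a point of least norm longer than [x0] cannot have a larger value *)
have fy n : f (y n) <= f x0.
  rewrite leNgt; apply/negP => /ltW /((yP n).1.2 _ Fx0); apply/negP.
  rewrite -ltNge.
  by apply: le_lt_trans (yP n).2; rewrite lerDr.
have [phi [v [nphi v0 vrec Qv zv]]] := asymptotic_direction dot_norm
  (feasible_convex Ti_sa Ti_psd (ci := ci) (alpha := alpha))
  Fcl Qleg Qrec Fy yn fy.
pose z n := y (phi n).
have zn n : n.+1%:R <= `|z n|.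
  by apply: le_trans (yn _); rewrite ler_nat ltnS.
have shorter : \forall n \near \oo, `|z n - v| < `|z n|.
  have vv : 0 < dot v v by exact: neq0_dnorm_gt0.
  apply: filterS (dot_large_along (dot v v) zn zv vv) => n zvn.
  rewrite -(@ltr_pXn2r _ 2) ?nnegrE// -!(dot_sqr_norm dot_norm) !dotE.
  by rewrite (dotC dot (z n) v); lra.
have feas : \forall n \near \oo, F (z n - v).
  apply: filter_forall => i.
  have [Tv0 civ] := feasible_recession dot_norm Ti_sa Ti_psd Fx0 vrec i.
  have gE n : quadratic_fun dot (Ti i) (ci i) (alpha i) (z n - v) =
      quadratic_fun dot (Ti i) (ci i) (alpha i) (z n) - dot (ci i) v.
    rewrite -scaleN1r quadratic_funD// Tv0 linear0r mulr0 addr0 mulN1r.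
    by rewrite dotDl Ti_sa Tv0 linear0r add0r.
  have [civ0|civ_neq0] := eqVneq (dot (ci i) v) 0.
    by apply: nearW => n; rewrite gE civ0 subr0; exact: (Fy (phi n)).
  have Ti0 : Ti i = (fun=> 0) :> (H -> H).
    apply: contrapT => Tin0; move/eqP: civ_neq0; apply.
    exact: (condA v vrec Qv i Tin0).
  (* an affine constraint, whose value at [z n] tends to minus infinity *)
  have civ_lt0 : 0 < dot (- ci i) v.
    by rewrite dotNl oppr_gt0 lt_neqAle civ_neq0.
  apply: filterS (dot_large_along (alpha i - dot (ci i) v) zn zv civ_lt0) => n.
  rewrite gE /quadratic_fun Ti0 linear0r mulr0 add0r dotNl; lra.
have [n [Fzv zvn]] := filter_ex (filterI feas shorter).
have [_ zmin] := (yP (phi n)).1.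
have : f (z n - v) <= f (z n).
  rewrite /f -scaleN1r quadratic_funD// Qv mulr0 addr0 mulN1r gerBl.
  by apply: grad => //; exact: Fy.
by move=> /(zmin _ Fzv); rewrite leNgt zvn.
Qed.
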